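(* The pseudovariety of ordered monoids $\mathsf J^+=[\![1\le x]\!]$ is word-reducible for the inequality $x\le y$. That is: for every finite set $A$, every finite monoid $M$, every onto continuous homomorphism $\varphi:\overline{\Omega}_A\mathsf M\to M$ and all $s,t\in M$, if there exist $u,v\in\overline{\Omega}_A\mathsf M$ with $\mathsf J^+\models u\le v$, $\varphi(u)=s$ and $\varphi(v)=t$, then there exist words $u',v'\in A^*$ with $\mathsf J^+\models u'\le v'$, $\varphi(u')=s$ and $\varphi(v')=t$.
   Context: $\mathsf M$ is the class of all finite monoids, and $\overline{\Omega}_A\mathsf M$ is the free profinite monoid on the finite set $A$; its elements are called pseudowords, and the free monoid $A^*$ is a dense submonoid. Each $w\in\overline{\Omega}_A\mathsf M$ is interpreted in a finite monoid $N$ as the operation $w_N:N^A\to N$, $w_N(\theta)=\hat\theta(w)$, where $\hat\theta:\overline{\Omega}_A\mathsf M\to N$ is the unique continuous homomorphism extending $\theta:A\to N$. A finite ordered monoid is a finite monoid with a partial order compatible with multiplication on both sides. It satisfies $u\le v$ (for $u,v\in\overline{\Omega}_A\mathsf M$) if $u_N(\theta)\le v_N(\theta)$ for all $\theta\in N^A$; $\mathsf V\models u\le v$ means that all members of $\mathsf V$ satisfy $u\le v$. $\mathsf J^+=[\![1\le x]\!]$ is the class of all finite ordered monoids in which $1\le m$ for every element $m$. *)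

(* Defs.v *)
From HB Require Import structures.
From mathcomp Require Import all_boot all_order monoid.
From mathcomp Require Import all_classical topology.

Set Implicit Arguments.
Unset Strict Implicit.
Unset Printing Implicit Defensive.

Local Open Scope classical_set_scope.
Local Open Scope group_scope.

#[short(type="finMonoidType")]
HB.structure Definition FinMonoid := {M of monoid.Monoid M & Finite M}.

HB.mixin Record isOrderedMonoid (d : Order.disp_t) M
    of monoid.Monoid M & Order.POrder d M := {
  lemulg2l : forall a x y : M, (x <= y)%O -> (a * x <= a * y)%O;
  lemulg2r : forall a x y : M, (x <= y)%O -> (x * a <= y * a)%O
}.

#[short(type="finOrdMonoidType")]
HB.structure Definition FinOrdMonoid (d : Order.disp_t) :=
  {M of isOrderedMonoid d M & FinMonoid M & Order.POrder d M}.

(* A finite monoid together with a map from A. Up to isomorphism one may take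
   'I_n as carrier, so that these objects form a type in the same universe as
   A and can index a product. *)
Record labelled_monoid (A : Type) := LabelledMonoid {
  lm_card : nat;
  lm_mul : 'I_lm_card -> 'I_lm_card -> 'I_lm_card;
  lm_one : 'I_lm_card;
  lm_mulA : associative lm_mul;
  lm_mul1g : left_id lm_one lm_mul;
  lm_mulg1 : right_id lm_one lm_mul;
  lm_label : A -> 'I_lm_card
}.

HB.instance Definition _ (A : Type) := gen_eqMixin (labelled_monoid A).
HB.instance Definition _ (A : Type) := gen_choiceMixin (labelled_monoid A).

Definition lm_carrier (A : Type) (i : labelled_monoid A) : Type :=
  'I_(lm_card i).

HB.instance Definition _ (A : Type) (i : labelled_monoid A) :=
  Finite.on (lm_carrier i).
HB.instance Definition _ (A : Type) (i : labelled_monoid A) :=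
  isMonoid.Build (lm_carrier i) (@lm_mulA A i) (@lm_mul1g A i) (@lm_mulg1 A i).

Section FreeProfiniteMonoid.
Variable A : finType.

Definition lm_product : Type :=
  prod_topology (fun i : labelled_monoid A => discrete_topology (lm_carrier i)).

HB.instance Definition _ := Topological.on lm_product.

Definition word_value (w : seq A) : lm_product :=
  fun i => \prod_(a <- w) (lm_label i a : lm_carrier i).

(* The free profinite monoid on A: the closure of the image of the free monoid
   in the product of all finite discrete monoids labelled by A. *)
Definition pseudoword : Type := set_type (closure (range word_value)).

HB.instance Definition _ := Topological.on pseudoword.

Definition lm_product_mul (x y : lm_product) : lm_product :=
  fun i => (x i : lm_carrier i) * y i.

Lemma cvg_lm_product (F : set_system lm_product) (FF : Filter F)
    (x : lm_product) :
  (forall i, F [set y | y i = x i]) -> F --> x.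
Proof.
move=> Fx; apply/cvg_sup => i U [V [[W /= oW WV] Vx VU]].
apply: (filterS _ (Fx i)) => y yx; apply: VU.
by rewrite -WV /= yx; move: Vx; rewrite -WV.
Qed.

Lemma nbhs_coord (x : lm_product) i : nbhs x [set y : lm_product | y i = x i].
Proof.
have := @proj_continuous _
  (fun i : labelled_monoid A => discrete_topology (lm_carrier i)) i x.
move=> pc; exact: (pc _ (@discrete_set1 (discrete_topology (lm_carrier i)) (x i))).
Qed.

Lemma lm_product_mul_continuous :
  continuous (fun p : lm_product * lm_product => lm_product_mul p.1 p.2).
Proof.
move=> [x y]; apply: cvg_lm_product => i /=.
exists ([set z : lm_product | z i = x i], [set z : lm_product | z i = y i]).
  by split; exact: nbhs_coord.
by move=> [u v] [/= ux vy]; rewrite /lm_product_mul /= ux vy.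
Qed.

Lemma word_value_cat (v w : seq A) :
  word_value (v ++ w) = lm_product_mul (word_value v) (word_value w).
Proof. by apply: functional_extensionality_dep => i; exact: big_cat. Qed.

Lemma pseudoword_mul_subproof (x y : pseudoword) :
  lm_product_mul (\val x) (\val y) \in closure (range word_value).
Proof.
apply/mem_set => B /(@lm_product_mul_continuous (\val x, \val y)).
move=> [[U V] /= [Ux Vy] UVB].
have [_ [[v _ <-] Uv]] := set_mem (valP x) _ Ux.
have [_ [[w _ <-] Vw]] := set_mem (valP y) _ Vy.
exists (word_value (v ++ w)); split; first by exists (v ++ w).
by rewrite word_value_cat; exact: (UVB (word_value v, word_value w)).
Qed.

Definition pseudoword_of_word (w : seq A) : pseudoword :=
  exist (fun x => x \in closure (range word_value)) (word_value w)
    (mem_set (subset_closure (ex_intro2 _ _ w I erefl))).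

Definition pseudoword_mul (x y : pseudoword) : pseudoword :=
  exist (fun z => z \in closure (range word_value))
    (lm_product_mul (\val x) (\val y)) (pseudoword_mul_subproof x y).

Definition pseudoword_one : pseudoword := pseudoword_of_word [::].

Lemma pseudoword_mulA : associative pseudoword_mul.
Proof.
move=> x y z; apply: val_inj; apply: functional_extensionality_dep => i.
exact: (@mulgA (lm_carrier i)).
Qed.

Lemma pseudoword_mul1g : left_id pseudoword_one pseudoword_mul.
Proof.
move=> x; apply: val_inj; apply: functional_extensionality_dep => i.
rewrite /= /lm_product_mul /word_value big_nil; exact: (@mul1g (lm_carrier i)).
Qed.

Lemma pseudoword_mulg1 : right_id pseudoword_one pseudoword_mul.
Proof.
move=> x; apply: val_inj; apply: functional_extensionality_dep => i.
rewrite /= /lm_product_mul /word_value big_nil; exact: (@mulg1 (lm_carrier i)).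
Qed.

HB.instance Definition _ := isMonoid.Build pseudoword
  pseudoword_mulA pseudoword_mul1g pseudoword_mulg1.

Definition letter (a : A) : pseudoword := pseudoword_of_word [:: a].

Definition word (w : seq A) : pseudoword := \prod_(a <- w) letter a.

Lemma val_word (w : seq A) : \val (word w) = word_value w.
Proof.
elim: w => [|a w IHw]; first by rewrite /word big_nil.
rewrite /word big_cons -cat1s word_value_cat -IHw.
by [].
Qed.

Lemma dense_word : dense (range word).
Proof.
move=> O [x Ox] [O' oO' O'O].
have xO' : O' (\val x) by move: Ox; rewrite -O'O.
have [_ [[w _ <-] O'w]] :=
  set_mem (valP x) _ (open_nbhs_nbhs (conj oO' xO')).
exists (word w); split; last by exists w.
by rewrite -O'O; change (O' (\val (word w))); rewrite val_word.
Qed.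

Lemma pseudoword_mul_continuous :
  continuous (fun p : pseudoword * pseudoword => p.1 * p.2).
Proof.
move=> [x y] U [V [[W oW WV] Vxy VU]].
have Wxy : W (lm_product_mul (\val x) (\val y)) by move: Vxy; rewrite -WV.
have := @lm_product_mul_continuous (\val x, \val y) W
  (open_nbhs_nbhs (conj oW Wxy)).
move=> [[P Q] /= [Px Qy] PQW].
exists ((set_val : pseudoword -> _) @^-1` P,
        (set_val : pseudoword -> _) @^-1` Q).
  by split; exact: initial_continuous.
by move=> [u v] [/= Pu Qv]; apply: VU; rewrite -WV; exact: (PQW (_, _)).
Qed.

Lemma nbhs_val_coord (x : pseudoword) i :
  nbhs x [set y : pseudoword | \val y i = \val x i].
Proof.
exact: (@initial_continuous _ _ (set_val : pseudoword -> _) x _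
  (@nbhs_coord (\val x) i)).
Qed.

Lemma hausdorff_pseudoword : hausdorff_space pseudoword.
Proof.
move=> x y xy; apply: val_inj; apply: functional_extensionality_dep => i.
by have [u [/= <- <-]] := xy _ _ (nbhs_val_coord x i) (nbhs_val_coord y i).
Qed.

Lemma compact_pseudoword : compact [set: pseudoword].
Proof.
have cP : compact [set: lm_product].
  have := @tychonoff (labelled_monoid A)
    (fun i => discrete_topology (lm_carrier i)) (fun=> setT).
  move=> /(_ _)/(_ _); rewrite (_ : [set f | _] = setT).
      by apply=> i; apply: finite_compact; exact: (@finite_finset (lm_carrier i)).
  by apply/seteqP; split.
have cC : compact (closure (range word_value)).
  by apply: (subclosed_compact _ cP) => //; exact: closed_closure.
move=> F FF _.
have [|p [Cp clp]] := cC (set_val @ F) _.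
  apply: (@filterE _ F FF) => x /=; rewrite set_valE; exact: (set_mem (valP x)).
exists (exist (fun z => z \in closure (range word_value)) p (mem_set Cp)).
split=> // U V FU [V' [[W oW WV] V'p V'V]].
have Wp : W p by move: V'p; rewrite -WV.
have [|_ [[x Ux <-] Wx]] := clp (set_val @` U) W _ (open_nbhs_nbhs (conj oW Wp)).
  by apply: (@filterS _ F _ U) => // x Ux; exists x.
by exists x; split => //; apply: V'V; rewrite -WV.
Qed.

End FreeProfiniteMonoid.

Section Interpretation.
Variables (A : finType) (N : finMonoidType) (theta : A -> N).

Definition tr_mul (x y : 'I_#|N|) := enum_rank (enum_val x * enum_val y).
Definition tr_one : 'I_#|N| := enum_rank (1 : N).

Lemma tr_mulA : associative tr_mul.
Proof. by move=> x y z; rewrite /tr_mul !enum_rankK mulgA. Qed.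
Lemma tr_mul1g : left_id tr_one tr_mul.
Proof. by move=> x; rewrite /tr_mul enum_rankK mul1g enum_valK. Qed.
Lemma tr_mulg1 : right_id tr_one tr_mul.
Proof. by move=> x; rewrite /tr_mul enum_rankK mulg1 enum_valK. Qed.

Definition labelled_of : labelled_monoid A :=
  LabelledMonoid tr_mulA tr_mul1g tr_mulg1 (fun a => enum_rank (theta a)).

(* The coordinate of w at N labelled by theta; the lemmas below characterize it
   as the unique continuous homomorphism extending theta. *)
Definition hat (w : pseudoword A) : N :=
  enum_val (\val w labelled_of : 'I_#|N|).

Lemma hat_morphism : monoid_morphism hat.
Proof.
split=> [|x y]; last by rewrite /hat /= /lm_product_mul /= enum_rankK.
by rewrite /hat /= /word_value big_nil enum_rankK.
Qed.

Lemma hat_letter a : hat (letter a) = theta a.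
Proof. by rewrite /hat /= /word_value big_seq1 /= enum_rankK. Qed.

Lemma hat_continuous : continuous (hat : _ -> discrete_topology N).
Proof.
move=> x U /principal_filterP Ux.
apply: filterS (nbhs_val_coord x labelled_of) => y /= yx.
suff -> : hat y = hat x by [].
by congr (enum_val _).
Qed.

Lemma hat_unique (f : pseudoword A -> N) :
  monoid_morphism f -> continuous (f : _ -> discrete_topology N) ->
  (forall a, f (letter a) = theta a) -> f = hat.
Proof.
move=> [f1 fM] fC ftheta; apply/funext => x.
have fw w : f (word w) = hat (word w).
  have [h1 hM] := hat_morphism.
  elim: w => [|a w IHw]; rewrite /word ?big_nil ?f1 ?h1 // big_cons.
  by rewrite fM hM ftheta hat_letter IHw.
have nf : nbhs x [set y | f y = f x].
  exact: fC x _ (@discrete_set1 (discrete_topology N) (f x)).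
have nh : nbhs x [set y | hat y = hat x].
  exact: (@hat_continuous x _ (@discrete_set1 (discrete_topology N) (hat x))).
have : nbhs x ([set y | f y = f x] `&` [set y | hat y = hat x]).
  exact: filterI.
rewrite nbhsE => -[O [oO Ox] Oeq].
have [y [Oy [w _ ew]]] := @dense_word A O (ex_intro _ x Ox) oO.
have [/= <- <-] := Oeq _ Oy.
by rewrite -ew fw.
Qed.

Lemma hat_word (w : seq A) : hat (word w) = \prod_(a <- w) theta a.
Proof.
have [h1 hM] := hat_morphism.
elim: w => [|a w IHw]; rewrite /word ?big_nil ?h1 // !big_cons.
by rewrite hM hat_letter IHw.
Qed.

End Interpretation.

Section WordInjective.
Variables (A : finType) (n : nat).

Definition truncated_word : Type := n.-bseq A.
HB.instance Definition _ := Finite.on truncated_word.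

Lemma trunc_subproof (w : seq A) : size (take n w) <= n.
Proof. by rewrite size_take_min geq_minl. Qed.

Definition trunc (w : seq A) : truncated_word := Bseq (trunc_subproof w).

Definition trunc_mul (x y : truncated_word) : truncated_word :=
  trunc ((x : n.-bseq A) ++ (y : n.-bseq A)).

Lemma trunc_cat (v w : seq A) : trunc_mul (trunc v) (trunc w) = trunc (v ++ w).
Proof.
apply: val_inj => /=; rewrite !take_cat !size_take_min ltnNge geq_minl /=.
have [nv|vn] := ltnP n (size v).
  by rewrite subnn take0 cats0.
rewrite take_oversize //; congr (_ ++ _).
by rewrite take_takel // leq_subr.
Qed.

Lemma truncK (x : truncated_word) : trunc (x : n.-bseq A) = x.
Proof. by apply: val_inj; rewrite /= take_oversize // size_bseq. Qed.

Lemma trunc_mulA : associative trunc_mul.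
Proof.
by move=> x y z; rewrite -[x]truncK -[y]truncK -[z]truncK !trunc_cat catA.
Qed.

Lemma trunc_mul1g : left_id (trunc [::]) trunc_mul.
Proof. by move=> x; rewrite -[x]truncK trunc_cat. Qed.

Lemma trunc_mulg1 : right_id (trunc [::]) trunc_mul.
Proof. by move=> x; rewrite -[x]truncK trunc_cat cats0. Qed.

HB.instance Definition _ :=
  isMonoid.Build truncated_word trunc_mulA trunc_mul1g trunc_mulg1.

Lemma hat_trunc (w : seq A) :
  hat (fun a => trunc [:: a] : truncated_word) (word w) = trunc w.
Proof.
rewrite hat_word; elim: w => [|a w IHw]; first by rewrite big_nil.
by rewrite big_cons IHw; exact: trunc_cat.
Qed.

End WordInjective.

Lemma word_inj (A : finType) : injective (@word A).
Proof.
move=> v w vw; set n := maxn (size v) (size w).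
have : trunc n v = trunc n w by rewrite -!hat_trunc vw.
move=> /(congr1 val) /=.
by rewrite !take_oversize ?leq_maxl ?leq_maxr.
Qed.

Definition satisfies (d : Order.disp_t) (N : finOrdMonoidType d) (A : finType)
    (u v : pseudoword A) : Prop :=
  forall theta : A -> N, (hat theta u <= hat theta v)%O.

Definition ordered_monoid_class : Type :=
  forall d : Order.disp_t, finOrdMonoidType d -> Prop.

Definition models (V : ordered_monoid_class) (A : finType)
    (u v : pseudoword A) : Prop :=
  forall (d : Order.disp_t) (N : finOrdMonoidType d), V d N -> satisfies N u v.

Definition Jplus : ordered_monoid_class :=
  fun d N => forall m : N, (1 <= m)%O.

Lemma JplusP (d : Order.disp_t) (N : finOrdMonoidType d) :
  Jplus N <-> satisfies N 1 (letter tt).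
Proof.
split=> [JN theta|NJ m]; first by rewrite (hat_morphism theta).1.
by have := NJ (fun=> m); rewrite (hat_morphism _).1 hat_letter.
Qed.

Definition word_reducible_le (V : ordered_monoid_class) : Prop :=
  forall (A : finType) (M : finMonoidType) (phi : pseudoword A -> M),
    monoid_morphism phi ->
    continuous (phi : pseudoword A -> discrete_topology M) ->
    range phi = [set: M] ->
  forall s t : M,
    (exists u v : pseudoword A, [/\ models V u v, phi u = s & phi v = t]) ->
    exists u' v' : seq A,
      [/\ models V (word u') (word v'), phi (word u') = s
        & phi (word v') = t].

(* Main.v *)
Require Import Defs.
From HB Require Import structures.
From mathcomp Require Import all_boot all_order monoid.
From mathcomp Require Import all_classical topology.

(** On words, [Jplus] sees the subword order: inserting letters increases the
    value of a word when [1 <= m] always holds ([subseq_models_Jplus]).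
    Conversely, for each fixed word [w], a single monoid of [Jplus] recognizes
    the words having [w] as a subword ([hat_greedy]), and the subset it uses is
    an upset; so an inequality of pseudowords valid in [Jplus] transports the
    subwords of its left side to its right side ([models_greedy]).

    Pumping makes this enough. A word [u0] contains a subword of length at most
    [#|M|] with the same value in [M] ([short_subseq_prod]), so only finitely
    many subwords [w] matter. By density one can pick a word [u0] that agrees
    with [u] in [M] and in each of the finitely many monoids testing these [w].
    The short subword [w] of [u0] with value [s] is then a subword of [u], hence
    of [v], hence of any word [v0] that agrees with [v] in the monoid testing
    [w]. Taking [v0] to agree with [v] in [M] as well, the pair [w], [v0] is the
    one sought. *)

Set Implicit Arguments.
Unset Strict Implicit.
Unset Printing Implicit Defensive.

Local Open Scope classical_set_scope.
Local Open Scope group_scope.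

Fact inflation_display : Order.disp_t. Proof. exact: Order.Disp tt tt. Qed.

Section Inflation.
Variable k : nat.

(** The inflationary order-preserving self-maps of a chain (the Catalan
    monoid): [1 <= f] says that [f] is inflationary, which puts the monoid in
    [Jplus], and monotonicity makes composition compatible with the pointwise
    order. *)
Definition is_inflation (f : {ffun 'I_k.+1 -> 'I_k.+1}) : bool :=
  [forall i : 'I_k.+1, (i <= f i)%N] &&
  [forall i : 'I_k.+1, forall j : 'I_k.+1, (i <= j)%N ==> (f i <= f j)%N].

Record inflation := Inflation {
  inflation_fun :> {ffun 'I_k.+1 -> 'I_k.+1};
  _ : is_inflation inflation_fun
}.

HB.instance Definition _ := [isSub for inflation_fun].
HB.instance Definition _ := [Finite of inflation by <:].

Lemma inflation_ge (f : inflation) (i : 'I_k.+1) : (i <= f i)%N.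
Proof. by case: f => f /= /andP[/forallP]. Qed.

Lemma inflation_mono (f : inflation) (i j : 'I_k.+1) :
  (i <= j)%N -> (f i <= f j)%N.
Proof.
by case: f => f /= /andP[_ /forallP/(_ i)/forallP/(_ j)/implyP].
Qed.

Lemma is_inflationP (f : 'I_k.+1 -> 'I_k.+1) :
  (forall i : 'I_k.+1, (i <= f i)%N) ->
  (forall i j : 'I_k.+1, (i <= j)%N -> (f i <= f j)%N) ->
  is_inflation (finfun f).
Proof.
move=> fge fmono; apply/andP; split; apply/forallP => i; rewrite ffunE//.
by apply/forallP => j; apply/implyP; rewrite ffunE; exact: fmono.
Qed.

Definition inflation_one : inflation :=
  Inflation (@is_inflationP id (fun=> leqnn _) (fun _ _ => id)).

Lemma inflation_mul_subproof (f g : inflation) :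
  is_inflation (finfun (g \o f)).
Proof.
apply: is_inflationP => [i|i j ij] /=.
  exact: leq_trans (inflation_ge f i) (inflation_ge g _).
by do 2! apply: inflation_mono.
Qed.

(** Maps act on the right, so that the product over a word applies the maps of
    its letters from left to right. *)
Definition inflation_mul (f g : inflation) : inflation :=
  Inflation (inflation_mul_subproof f g).

Lemma inflation_mulA : associative inflation_mul.
Proof. by move=> f g h; apply/val_inj/ffunP => i; rewrite !ffunE /= !ffunE. Qed.
Lemma inflation_mul1g : left_id inflation_one inflation_mul.
Proof. by move=> f; apply/val_inj/ffunP => i; rewrite !ffunE /= !ffunE. Qed.
Lemma inflation_mulg1 : right_id inflation_one inflation_mul.
Proof. by move=> f; apply/val_inj/ffunP => i; rewrite !ffunE /= !ffunE. Qed.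

HB.instance Definition _ := isMonoid.Build inflation
  inflation_mulA inflation_mul1g inflation_mulg1.

Lemma inflation1E i : (1 : inflation) i = i.
Proof. by rewrite ffunE. Qed.

Lemma inflationME (f g : inflation) i : (f * g) i = g (f i).
Proof. by rewrite ffunE. Qed.

Definition inflation_le (f g : inflation) : bool :=
  [forall i : 'I_k.+1, (f i <= g i)%N].

Lemma inflation_lexx : reflexive inflation_le.
Proof. by move=> f; apply/forallP => i. Qed.

Lemma inflation_le_anti : antisymmetric inflation_le.
Proof.
move=> f g /andP[/forallP fg /forallP gf]; apply/val_inj/ffunP => i.
by apply/val_inj/eqP; rewrite eqn_leq fg gf.
Qed.

Lemma inflation_le_trans : transitive inflation_le.
Proof.
move=> g f h /forallP fg /forallP gh; apply/forallP => i.
exact: leq_trans (fg i) (gh i).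
Qed.

HB.instance Definition _ := Order.Le_isPOrder.Build inflation_display inflation
  inflation_lexx inflation_le_anti inflation_le_trans.

Lemma le_inflationP (f g : inflation) :
  reflect (forall i : 'I_k.+1, (f i <= g i)%N) (f <= g)%O.
Proof. exact: forallP. Qed.

Lemma inflation_lemulg2l (h f g : inflation) : (f <= g)%O -> (h * f <= h * g)%O.
Proof.
by move=> /le_inflationP fg; apply/le_inflationP => i; rewrite !inflationME.
Qed.

Lemma inflation_lemulg2r (h f g : inflation) : (f <= g)%O -> (f * h <= g * h)%O.
Proof.
move=> /le_inflationP fg; apply/le_inflationP => i; rewrite !inflationME.
exact: inflation_mono.
Qed.

HB.instance Definition _ := isOrderedMonoid.Build inflation_display inflation
  inflation_lemulg2l inflation_lemulg2r.

Lemma Jplus_inflation : @Jplus inflation_display inflation.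
Proof.
by move=> f; apply/le_inflationP => i; rewrite inflation1E; exact: inflation_ge.
Qed.

End Inflation.

Section GreedyMatching.
Variables (A : finType) (w : seq A).

(** State [i] means that the prefix of length [i] of [w] has been matched by the
    letters read so far; the next letter is used as soon as it fits. In the last
    state [onth] returns [None], so the sum never exceeds [size w]. *)
Definition greedy_step (a : A) (i : 'I_(size w).+1) : 'I_(size w).+1 :=
  inord (i + (onth w i == Some a)).

Lemma val_greedy_step a i :
  greedy_step a i = i + (onth w i == Some a) :> nat.
Proof.
rewrite inordK // ltnS; have [wi|_] := eqP; last by rewrite addn0 -ltnS.
by rewrite addn1 -onthTE wi.
Qed.

Lemma greedy_subproof a : is_inflation (finfun (greedy_step a)).
Proof.
apply: is_inflationP => [i|i j]; rewrite !val_greedy_step ?leq_addr //.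
rewrite leq_eqVlt => /predU1P[/val_inj->//|ij].
(* For i < j the step from i gains at most one, hence does not pass j. *)
apply: leq_trans (leq_trans ij (leq_addr _ _)).
by rewrite -[X in (_ <= X)%N]addn1 leq_add2l leq_b1.
Qed.

Definition greedy (a : A) : inflation (size w) := Inflation (greedy_subproof a).

(** Greedy matching is optimal, and it is the recursion that defines [subseq]:
    state [i] stands for the suffix [drop i w] that remains to be matched. *)
Lemma greedy_subseq (v : seq A) (i : 'I_(size w).+1) :
  subseq (drop i w) v =
  ((\prod_(a <- v) greedy a : inflation (size w)) i == ord_max).
Proof.
elim: v i => [|a v IHv] i.
  rewrite big_nil inflation1E subseq0 -size_eq0 size_drop subn_eq0.
  by rewrite -val_eqE /= eqn_leq leq_ord.
rewrite big_cons inflationME -IHv /= ffunE val_greedy_step.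
have [iw|wi] := ltnP i (size w); last first.
  by rewrite !drop_oversize ?sub0seq // (leq_trans wi) ?leq_addr.
rewrite (drop_nth a iw) onthE (nth_map a) // (inj_eq Some_inj).
have [_|_] := eqVneq (nth a w i) a; first by rewrite addn1.
by rewrite addn0 (drop_nth a iw).
Qed.

Lemma hat_greedy (v : seq A) :
  (hat greedy (word v) ord0 == ord_max) = subseq w v.
Proof. by rewrite hat_word -greedy_subseq drop0. Qed.

(** The property tested by [greedy], reaching the top state, is preserved when
    the map gets larger. *)
Lemma models_greedy (u v : pseudoword A) :
  models Jplus u v -> hat greedy u ord0 = ord_max -> hat greedy v ord0 = ord_max.
Proof.
move=> /(_ _ _ (@Jplus_inflation (size w)) greedy)/le_inflationP/(_ ord0) uv um.
move: uv; rewrite um => vm.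
by apply/val_inj/eqP; rewrite eqn_leq vm leq_ord.
Qed.

End GreedyMatching.

(** A letter of [v] that is skipped in [u] is compared with [1]. *)
Lemma subseq_models_Jplus (A : finType) (u v : seq A) :
  subseq u v -> models Jplus (word u) (word v).
Proof.
move=> + d N NJ theta; rewrite !hat_word.
elim: v u => [|a v IHv] [|b u] //= uv; try by rewrite big_nil; exact: NJ.
rewrite [\prod_(c <- a :: v) _]big_cons; move: uv; case: eqVneq => [->|_] uv.
  by rewrite big_cons; apply: lemulg2l; exact: IHv.
apply: Order.le_trans (IHv _ uv) _.
by rewrite -{1}[\prod_(c <- v) _]mul1g; apply: lemulg2r; exact: NJ.
Qed.

(** Pumping: a word with more than [#|M|] letters has two distinct prefixes of
    equal value, and the factor between them can be cut out. *)
Lemma short_subseq_prod (A : eqType) (M : finMonoidType) (theta : A -> M)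
    (u : seq A) :
  exists w : #|M|.-bseq A,
    subseq w u /\ \prod_(a <- w) theta a = \prod_(a <- u) theta a.
Proof.
have [n] := ubnP (size u); elim: n => // n IHn in u *; rewrite ltnS => un.
have [uM|Mu] := leqP (size u) #|M|.
  by exists (Bseq uM); rewrite subseq_refl.
pose pref (i : 'I_(size u).+1) := \prod_(a <- take i u) theta a.
have /injectivePn[i [j ij prefij]] : ~~ injectiveb pref.
  apply/negP => /injectiveP/leq_card; rewrite card_ord.
  by rewrite leqNgt ltnS ltnW.
wlog {ij} ltij : i j prefij / (i < j)%N.
  move=> wl; move: ij; rewrite -val_eqE neq_ltn => /orP[]; first exact: wl.
  exact: wl (esym prefij).
have cut : (size (take i u ++ drop j u) < size u)%N.
  rewrite size_cat size_drop size_takel ?leq_ord //.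
  by rewrite addnC -ltn_subRL subKn ?leq_ord.
have [w [wu wprod]] := IHn _ (leq_trans cut un).
exists w; split.
  apply: subseq_trans wu _; rewrite -[X in subseq _ X](cat_take_drop i u).
  apply: cat_subseq => //.
  by rewrite -(subnK (ltnW ltij)) -drop_drop drop_subseq.
by rewrite wprod big_cat [\prod_(a <- take i u) _]prefij -big_cat cat_take_drop.
Qed.

Lemma nbhs_fiber (A : finType) (N : finMonoidType) (f : pseudoword A -> N) x :
  continuous (f : _ -> discrete_topology N) -> nbhs x [set y | f y = f x].
Proof.
by move=> fC; exact: fC x _ (@discrete_set1 (discrete_topology N) (f x)).
Qed.

Lemma nbhs_word (A : finType) (x : pseudoword A) (B : set (pseudoword A)) :
  nbhs x B -> exists w, B (word w).
Proof.
rewrite nbhsE => -[O [oO Ox] OB].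
have [y [Oy [w _ wy]]] := @dense_word A O (ex_intro _ x Ox) oO.
by exists w; apply: OB; rewrite wy.
Qed.

Theorem proposition3 : word_reducible_le Jplus.
Proof.
move=> A M phi phiM phiC _ s t [u [v [uv us vt]]].
have phi_word w : phi (word w) = \prod_(a <- w) phi (letter a).
  have phi_hat : phi = hat (phi \o letter (A := A)) by exact: hat_unique.
  by rewrite {1}phi_hat hat_word.
(* The testing monoids must be fixed before u0, hence for all short w at once. *)
have [u0 [u0s u0u]] : exists u0, phi (word u0) = s /\ forall w : #|M|.-bseq A,
    hat (greedy w) (word u0) = hat (greedy w) u.
  apply: (@nbhs_word _ u [set y | phi y = s /\ forall w : #|M|.-bseq A,
    hat (greedy w) y = hat (greedy w) u]).
  apply: filterI; first by rewrite -us; exact: nbhs_fiber.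
  apply: (@filter_forall _ _ (fun (w : #|M|.-bseq A) y =>
    hat (greedy w) y = hat (greedy w) u) _ (nbhs_filter u)) => w.
  apply: nbhs_fiber; exact: hat_continuous.
have [w [wu0 ws]] := short_subseq_prod (phi \o letter (A := A)) u0.
have wv : hat (greedy w) v ord0 = ord_max.
  by apply: (models_greedy uv); rewrite -u0u; apply/eqP; rewrite hat_greedy.
have [v0 [v0t v0v]] : exists v0, phi (word v0) = t /\
    hat (greedy w) (word v0) = hat (greedy w) v.
  apply: (@nbhs_word _ v [set y | phi y = t /\
    hat (greedy w) y = hat (greedy w) v]).
  apply: filterI; first by rewrite -vt; exact: nbhs_fiber.
  apply: nbhs_fiber; exact: hat_continuous.
exists w, v0; split=> //.
  by apply: subseq_models_Jplus; rewrite -hat_greedy v0v wv.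
by rewrite phi_word ws -phi_word.
Qed.
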